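(* For every $k\ge 2$ and every pair $u$ and $u'$ of distinct oriented words of rank $k$, the orders $\leq_u$ and $\leq_{u'}$ induced by $u$ and $u'$ on $F_k$ are distinct.
   Context: Let $k\ge 2$ and let $\mathcal{A}=\{a_1,\dots,a_k\}$ be a basis of the free group $F_k$. For $a\in\mathcal{A}$ the inverse is denoted by the corresponding uppercase letter ($A=a^{-1}$, $B=b^{-1}$, $A_i=a_i^{-1}$). Letters in $\mathcal{A}$ are called positive (lowercase), letters in $\mathcal{A}^{-1}$ negative (uppercase), and $\mathcal{A}^{\pm}=\mathcal{A}\cup\mathcal{A}^{-1}$. Elements of $F_k$ are identified with reduced group words over $\mathcal{A}^\pm$; $e$ is the trivial element. An oriented word of rank $k$ is a word of length $2k$ over $\mathcal{A}^\pm$ containing each letter of $\mathcal{A}^\pm$ exactly once. For distinct $x,y\in\mathcal{A}^\pm$, ''$x..y$ in $u$'' means that $x$ is to the left of $y$ in $u$. $\#_w(g)$ is the number of (possibly overlapping) occurrences of $w$ as a contiguous subword of $g$. For an oriented word $u$ of rank $k$ and a reduced word $g$, define $$\alpha_u(g)=\sum_{a,b\in\mathcal{A},\ A..B\text{ in }u}\#_{aB}(g)-\sum_{a,b\in\mathcal{A},\ a..b\text{ in }u}\#_{Ba}(g),$$ $$\beta_u(g)=\sum_{a,b\in\mathcal{A},\ A..b\text{ in }u}\#_{ab}(g)-\sum_{a,b\in\mathcal{A},\ A..b\text{ in }u}\#_{BA}(g)$$ (sums over ordered pairs $(a,b)$; in $\beta_u$ the case $a=b$ is allowed), and let $\omega(g)=\frac12$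 if the last letter of $g$ is in $\mathcal{A}$, $\omega(g)=-\frac12$ if it is in $\mathcal{A}^{-1}$, $\omega(e)=0$. The weight induced by $u$ is $\tau_u=\alpha_u+\beta_u+\omega$ (always evaluated on reduced forms). The left order $\leq_u$ on $F_k$ induced by $u$ is the one with positive cone $P_u=\{g\in F_k\mid\tau_u(g)>0\}$, i.e. $g<_u h$ if and only if $g^{-1}h\in P_u$. *)

(* Defs.v *)
From HB Require Import structures.
From mathcomp Require Import all_boot all_order all_algebra.

Set Implicit Arguments.
Unset Strict Implicit.
Unset Printing Implicit Defensive.

Import Order.TTheory GRing.Theory Num.Theory.

(* [(i, true)] is the basis element a_i (lowercase letter) and [(i, false)] is
   its inverse A_i (uppercase letter). *)
Notation letter k := ('I_k * bool)%type.

Definition pos k (a : 'I_k) : letter k := (a, true).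
Definition neg k (a : 'I_k) : letter k := (a, false).

Definition is_pos k (x : letter k) : bool := x.2.

Definition linv k (x : letter k) : letter k := (x.1, ~~ x.2).

Section FreeGroup.

Variable k : nat.
Implicit Types (x y : letter k) (s t w : seq (letter k)).

Definition reduced w : bool := sorted (fun x y => y != linv x) w.

Record freegroup := FreeGroup {
  fgval :> seq (letter k);
  fgvalP : reduced fgval
}.

HB.instance Definition _ := [isSub for fgval].
HB.instance Definition _ := [Countable of freegroup by <:].

(* The reduced form of x w, for w reduced. *)
Definition push x w :=
  if w is y :: w' then (if y == linv x then w' else x :: w) else [:: x].

(* The reduced form of the concatenation s ++ t, for t reduced. *)
Definition wmul s t := foldr push t s.

Definition winv w := rev (map (@linv k) w).

Lemma linvK : involutive (@linv k).
Proof. by case=> a b; rewrite /linv /= negbK. Qed.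

Lemma reduced_cons x w : reduced (x :: w) -> reduced w.
Proof. exact: path_sorted. Qed.

Lemma push_reduced x w : reduced w -> reduced (push x w).
Proof.
case: w => [|y w] //= yw; case: ifP => [_|/negbT yx].
  exact: path_sorted yw.
by rewrite /= yx.
Qed.

Lemma wmul_reduced s t : reduced t -> reduced (wmul s t).
Proof. by move=> rt; elim: s => //= x s; apply: push_reduced. Qed.

Lemma pushK x w : reduced w -> push (linv x) (push x w) = w.
Proof.
case: w => [|y w] /=; first by rewrite linvK eqxx.
case: (eqVneq y (linv x)) => [->|ne] rw /=; last by rewrite linvK eqxx.
case: w rw => [|z w] //= /andP[/negbTE nz _].
by rewrite nz.
Qed.

Lemma wmul1 s : reduced s -> wmul s [::] = s.
Proof.
elim: s => //= x [|y s] IH // rs.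
rewrite (IH (reduced_cons rs)) /=.
by move: rs => /= /andP[/negbTE-> _].
Qed.

Lemma wmul_push x s t : reduced t -> wmul (push x s) t = push x (wmul s t).
Proof.
move=> rt; case: s => [|y s] //=; case: eqP => [->|] //=.
by have := pushK (linv x) (wmul_reduced s rt); rewrite linvK => ->.
Qed.

Lemma wmulA s t w : reduced w -> wmul s (wmul t w) = wmul (wmul s t) w.
Proof. by move=> rw; elim: s => //= x s ->; rewrite wmul_push. Qed.

Lemma winvK : involutive winv.
Proof. by move=> s; rewrite /winv map_rev revK mapK //; apply: linvK. Qed.

Lemma winv_reduced w : reduced w -> reduced (winv w).
Proof.
rewrite /reduced /winv rev_sorted sorted_map; apply: sub_sorted => x y.
by apply: contraNneq => /= ->; rewrite linvK.
Qed.

Lemma wmulVw w : reduced w -> wmul (winv w) w = [::].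
Proof.
elim: w => //= x w IH rw.
rewrite /winv map_cons rev_cons /wmul foldr_rcons /= linvK eqxx.
exact: IH (reduced_cons rw).
Qed.

Lemma wmulwV w : reduced w -> wmul w (winv w) = [::].
Proof. by move=> rw; rewrite -{1}[w]winvK wmulVw // winv_reduced. Qed.

Definition fgone : freegroup := @FreeGroup [::] isT.
Definition fgmul (g h : freegroup) : freegroup :=
  FreeGroup (wmul_reduced g (fgvalP h)).
Definition fginv (g : freegroup) : freegroup :=
  FreeGroup (winv_reduced (fgvalP g)).

Lemma fgmulA : associative fgmul.
Proof. by move=> f g h; apply: val_inj; rewrite /= wmulA // fgvalP. Qed.

Lemma fgmul1g : left_id fgone fgmul.
Proof. by move=> g; apply: val_inj. Qed.

Lemma fgmulg1 : right_id fgone fgmul.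
Proof. by move=> g; apply: val_inj; rewrite /= wmul1 // fgvalP. Qed.

Lemma fgmulVg : left_inverse fgone fginv fgmul.
Proof. by move=> g; apply: val_inj; rewrite /= wmulVw // fgvalP. Qed.

Lemma fgmulgV : right_inverse fgone fginv fgmul.
Proof. by move=> g; apply: val_inj; rewrite /= wmulwV // fgvalP. Qed.

HB.instance Definition _ :=
  isGroup.Build freegroup fgmulA fgmul1g fgmulg1 fgmulVg fgmulgV.

End FreeGroup.

Definition oriented_word k (u : seq (letter k)) : Prop :=
  size u = k.*2 /\ forall x : letter k, count_mem x u = 1.

(* "x..y in u".  It is only used for an oriented word u; it is irreflexive, so
   that the diagonal terms a = b do not contribute to [alpha] below. *)
Definition before k (u : seq (letter k)) (x y : letter k) : bool :=
  index x u < index y u.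

(* Number of possibly overlapping occurrences of w as a contiguous subword. *)
Definition occ k (w g : seq (letter k)) : nat :=
  \sum_(i < (size g).+1) prefix w (drop i g).

Local Open Scope ring_scope.

Section Weight.

Variables (k : nat) (u : seq (letter k)).
Implicit Type g : freegroup k.

Definition alpha g : rat :=
  \sum_(a < k) \sum_(b < k | before u (neg a) (neg b))
     (occ [:: pos a; neg b] g)%:R
  - \sum_(a < k) \sum_(b < k | before u (pos a) (pos b))
     (occ [:: neg b; pos a] g)%:R.

Definition beta g : rat :=
  \sum_(a < k) \sum_(b < k | before u (neg a) (pos b))
     (occ [:: pos a; pos b] g)%:R
  - \sum_(a < k) \sum_(b < k | before u (neg a) (pos b))
     (occ [:: neg b; neg a] g)%:R.

Definition omega g : rat :=
  if fgval g is x :: s then (if is_pos (last x s) then 1 / 2 else - (1 / 2))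
  else 0.

Definition tau g : rat := alpha g + beta g + omega g.

Definition poscone : pred (freegroup k) := fun g => 0 < tau g.

Definition lt_induced : rel (freegroup k) :=
  fun g h => poscone (g^-1 * h)%g.

Definition le_induced : rel (freegroup k) :=
  fun g h => (g == h) || lt_induced g h.

End Weight.

(* Main.v *)
Require Import Defs.
From HB Require Import structures.
From mathcomp Require Import all_boot all_order all_algebra.
From mathcomp Require Import ring lra.

Set Implicit Arguments.
Unset Strict Implicit.
Unset Printing Implicit Defensive.

Import Order.TTheory GRing.Theory Num.Theory.

(** The weight of a nontrivial reduced word g collapses to

      tau_u(g) = 1/2 + #{consecutive letters xy of g | x^-1 .. y in u} - #{negative letters of g}

    ([tau_cons]): each of the four families of two-letter factors in alpha_u and
    beta_u asks one and the same question, whether x^-1 is to the left of y in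
    u, and charges 1 when x is negative; omega charges for the last letter.
    Hence g is positive exactly when its negative letters are no more numerous
    than its turns, the consecutive letters xy with x^-1 .. y in u
    ([poscone_cons]).

    So the positive cone determines u as soon as, for any two letters x and y,
    it contains the answer to the question x .. y.  For x and y of the same sign
    the word x^-1 y has one negative letter and its only turn is the one in
    question ([before_same_sign]).  For A and b, the word ab is always positive,
    and a third letter must be added to make the question decisive: abC works
    when C .. B, and Cab works when a .. c.  Such a letter is missing only if a
    is the last lowercase letter and B the first uppercase letter, and this
    leaves at most one pair A, b in doubt.  Two words with the same cone then
    agree on all other pairs; were they to differ on this last one, the
    comparisons that are forced on the others make abAB (if a <> b) or aacA (if
    a = b, with c another letter) positive for one order and negative for the
    other ([before_mixed_sub]).  The second case uses k >= 2.

    Finally an oriented word is the list of all letters sorted by its own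
    left-to-right relation, so it is recovered from that relation
    ([oriented_before_inj]). *)

(** * The left-to-right order of an oriented word *)

Section Before.

Variables (k : nat) (u : seq (letter k)).
Implicit Types x y z : letter k.

Lemma before_irr : irreflexive (before u).
Proof. by move=> x; apply: ltnn. Qed.

Lemma before_trans : transitive (before u).
Proof. by move=> y x z; apply: ltn_trans. Qed.

Lemma oriented_mem : oriented_word u -> forall x, x \in u.
Proof. by case=> _ cu x; rewrite -has_pred1 has_count cu. Qed.

Lemma oriented_uniq : oriented_word u -> uniq u.
Proof.
move=> hu; apply: count_mem_uniq => x.
by rewrite oriented_mem //; case: hu => _ ->.
Qed.

Lemma before_neg x y : oriented_word u -> x != y -> before u y x = ~~ before u x y.
Proof.
move=> hu ne; rewrite /before -leqNgt [RHS]leq_eqVlt; case: eqP => // e.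
have xy := index_inj x (oriented_mem hu y) (oriented_mem hu x) e.
by rewrite xy eqxx in ne.
Qed.

Lemma before_sorted : uniq u -> sorted (before u) u.
Proof.
case: u => // x0 s us; apply/(sortedP x0) => i lti.
by rewrite /before !index_uniq // ltnW.
Qed.

End Before.

(** Both words are the sorted enumeration of the letters for the same strict
    order, and such an enumeration is unique. *)
Lemma oriented_before_inj k (u u' : seq (letter k)) :
  oriented_word u -> oriented_word u' -> before u =2 before u' -> u = u'.
Proof.
move=> hu hu' e.
apply: (irr_sorted_eq (@before_trans _ u) (@before_irr _ u)).
- exact/before_sorted/oriented_uniq.
- by rewrite (eq_sorted e); apply/before_sorted/oriented_uniq.
- by move=> x; rewrite !oriented_mem.
Qed.

(** * The weight counts turns against negative letters *)

(** The word is [x :: s], split so that [pairmap] runs through its consecutive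
    letters. *)
Definition turns k (u : seq (letter k)) x s : nat :=
  sumn (pairmap (fun y z => before u (linv y) z : nat) x s).

Definition negs k (s : seq (letter k)) : nat := count (fun x => ~~ is_pos x) s.

Lemma occ_cons k (w : seq (letter k)) x s :
  occ w (x :: s) = (prefix w (x :: s) + occ w s)%N.
Proof. by rewrite /occ big_ord_recl drop0. Qed.

Local Open Scope ring_scope.

(** Letters match a two-letter pattern for at most one pair of indices; [C] is
    the condition that their signs match. *)
Lemma sum_pair_indicator k (P : 'I_k -> 'I_k -> bool) (C : bool) (i j : 'I_k) :
  \sum_(a < k) \sum_(b < k | P a b) [&& C, a == i & b == j]%:R
  = (C && P i j)%:R :> rat.
Proof.
rewrite (bigD1 i) //= [X in _ + X]big1 ?addr0; last first.
  by move=> a /negbTE ->; rewrite big1 // => b _; rewrite andbF.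
rewrite big_mkcond (bigD1 j) //= big1 ?addr0 => [|b /negbTE ->].
  by rewrite !eqxx !andbT; case: (P i j); rewrite ?andbT ?andbF.
by rewrite !andbF if_same.
Qed.

(** This is [alpha + beta], on arbitrary words so that induction can remove
    letters one by one. *)
Definition turn_sum k (u s : seq (letter k)) : rat :=
  \sum_(a < k) \sum_(b < k | before u (neg a) (neg b))
     (occ [:: pos a; neg b] s)%:R
  - \sum_(a < k) \sum_(b < k | before u (pos a) (pos b))
     (occ [:: neg b; pos a] s)%:R
  + (\sum_(a < k) \sum_(b < k | before u (neg a) (pos b))
     (occ [:: pos a; pos b] s)%:R
  - \sum_(a < k) \sum_(b < k | before u (neg a) (pos b))
     (occ [:: neg b; neg a] s)%:R).

Lemma sum_occ_cons k (P : 'I_k -> 'I_k -> bool) (w : 'I_k -> 'I_k -> seq (letter k))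
    x s (C : bool) (i j : 'I_k) :
    (forall a b, prefix (w a b) (x :: s) = [&& C, a == i & b == j]) ->
  \sum_(a < k) \sum_(b < k | P a b) (occ (w a b) (x :: s))%:R
  = (C && P i j)%:R
    + \sum_(a < k) \sum_(b < k | P a b) (occ (w a b) s)%:R :> rat.
Proof.
move=> e; rewrite -sum_pair_indicator -big_split; apply: eq_bigr => a _ /=.
by rewrite -big_split; apply: eq_bigr => b _; rewrite occ_cons e natrD.
Qed.

Lemma turn_sum1 k (u : seq (letter k)) x : turn_sum u [:: x] = 0.
Proof.
rewrite /turn_sum /occ.
by rewrite !big1 ?subr0 ?addr0 // => a _; rewrite big1 // => b _;
   rewrite !big_ord_recl big_ord0 /= ?andbF.
Qed.

(** Each of the four sign patterns of [x y] is counted by exactly one of the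
    sums.  In the two sums that are subtracted [x] is negative: Ba is charged
    when a .. b, that is, unless b .. a, and BA when A .. b, that is, unless
    b .. A; in both cases, unless x^-1 .. y.  Here [y] must differ from x^-1,
    since only distinct letters are comparable. *)
Lemma turn_sum_cons k (u : seq (letter k)) x y s :
    oriented_word u -> y != linv x ->
  turn_sum u [:: x, y & s]
  = (before u (linv x) y)%:R - (~~ is_pos x)%:R + turn_sum u (y :: s).
Proof.
move=> hu; case: x y => [i sx] [j sy] ne.
rewrite /turn_sum.
rewrite (@sum_occ_cons k _ (fun a b => [:: pos a; neg b]) _ _ (sx && ~~ sy) i j); last first.
  move=> a b /=; rewrite prefix0s !xpair_eqE andbT.
  by case: sx sy ne => -[] _; rewrite ?andbF ?andbT ?(andbC (_ == j)).
rewrite (@sum_occ_cons k _ (fun a b => [:: neg b; pos a]) _ _ (~~ sx && sy) j i); last first.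
  move=> a b /=; rewrite prefix0s !xpair_eqE andbT.
  by case: sx sy ne => -[] _; rewrite ?andbF ?andbT //= andbC.
rewrite (@sum_occ_cons k _ (fun a b => [:: pos a; pos b]) _ _ (sx && sy) i j); last first.
  move=> a b /=; rewrite prefix0s !xpair_eqE andbT.
  by case: sx sy ne => -[] _; rewrite ?andbF ?andbT.
rewrite (@sum_occ_cons k _ (fun a b => [:: neg b; neg a]) _ _ (~~ sx && ~~ sy) j i); last first.
  move=> a b /=; rewrite prefix0s !xpair_eqE andbT.
  by case: sx sy ne => -[] _; rewrite ?andbF ?andbT //= andbC.
case: sx sy ne => -[] ne; rewrite /linv /is_pos /= -/(pos _) -/(neg _).
- ring.
- ring.
- by rewrite (before_neg hu ne); case: (before u (pos j) _) => /=; ring.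
- by rewrite (before_neg hu ne); case: (before u (neg j) _) => /=; ring.
Qed.

Lemma tau_cons k (u : seq (letter k)) x s (r : reduced (x :: s)) :
    oriented_word u ->
  tau u (FreeGroup r) = 1 / 2 + (turns u x s)%:R - (negs (x :: s))%:R.
Proof.
move=> hu; rewrite /tau -[alpha _ _ + _]/(turn_sum u (x :: s)).
rewrite /omega /=; elim: s x r => [|y s IH] x r.
  by rewrite turn_sum1 /negs /turns /=; case: is_pos => /=; lra.
have /= /andP[ne ry] := r.
rewrite turn_sum_cons // -addrA [last _ _]/= (IH _ ry) /turns /negs /= !natrD.
ring.
Qed.

(** The weight is half an odd integer, so that its sign is a comparison of
    natural numbers. *)
Lemma poscone_cons k (u : seq (letter k)) x s (r : reduced (x :: s)) :
    oriented_word u ->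
  poscone u (FreeGroup r) = (negs (x :: s) <= turns u x s)%N.
Proof.
move=> hu; rewrite /poscone tau_cons //.
case: leqP => [le|lt]; first by rewrite -(ler_nat rat) in le; lra.
by rewrite -(ler_nat rat) -natr1 in lt; apply/negbTE; rewrite -leNgt; lra.
Qed.

(** The cone is the set of elements above 1, except that reflexivity hides 1
    itself, whose weight is always 0. *)
Lemma le_induced_poscone k (u u' : seq (letter k)) :
  le_induced u =2 le_induced u' -> poscone u =1 poscone u'.
Proof.
move=> e g; have := e 1%g g; rewrite /le_induced /lt_induced invg1 mul1g.
case: eqP => // <- _; rewrite /poscone; suff t v : tau v (@fgone k) = 0 by rewrite !t.
rewrite /tau /alpha /beta /omega /= /occ !big1 ?subr0 ?addr0 //;
  by move=> a _; rewrite big1 // => b _; rewrite big_ord_recl big_ord0.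
Qed.

Local Close Scope ring_scope.

(** * Recovering the oriented word from its positive cone *)

Section Recover.

Variable k : nat.
Implicit Types u : seq (letter k).

Definition same_cone u u' :=
  [/\ oriented_word u, oriented_word u' & poscone u =1 poscone u'].

Lemma linv_pos (a : 'I_k) : linv (pos a) = neg a. Proof. by []. Qed.

Lemma linv_neg (a : 'I_k) : linv (neg a) = pos a. Proof. by []. Qed.

Lemma same_cone_sym u u' : same_cone u u' -> same_cone u' u.
Proof. by case=> hu hu' e; split=> // g; rewrite e. Qed.

Lemma same_cone_turns u u' x s : same_cone u u' -> reduced (x :: s) ->
  (negs (x :: s) <= turns u x s) = (negs (x :: s) <= turns u' x s).
Proof. by case=> hu hu' e r; rewrite -!(poscone_cons r) // e. Qed.

(** The word x^-1 y has exactly one negative letter, and is positive if and only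
    if it has a turn. *)
Lemma before_same_sign u u' x y : same_cone u u' -> x.2 = y.2 ->
  before u x y = before u' x y.
Proof.
move=> c; have [->|ne] := eqVneq x y; first by rewrite !before_irr.
case: x y ne => [i b] [j t] /= + ebt; rewrite -{t}ebt => ne.
have r : reduced [:: linv (i, b); (j, b)] by rewrite /= linvK eq_sym ne.
have := same_cone_turns c r; rewrite /turns /negs /= /linv /= negbK.
by case: b {ne r}; do 2 case: before.
Qed.

(** In abC there is one negative letter, and bC is not a turn since C .. B, for
    both words by [before_same_sign].  Hence abC is positive if and only if ab
    is a turn.  The case c = a is allowed. *)
Lemma before_mixed_nonmin u u' a b c : same_cone u u' ->
    before u (neg c) (neg b) ->
  before u (neg a) (pos b) = before u' (neg a) (pos b).
Proof.
move=> cn lt; have lt' := lt; rewrite (before_same_sign cn) // in lt'.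
have ne : c != b by apply: contraTneq lt => ->; rewrite before_irr.
have r : reduced [:: pos a; pos b; neg c].
  by rewrite /= !xpair_eqE /= (negbTE ne) !andbF.
have [hu hu' _] := cn.
have := same_cone_turns cn r; rewrite /turns /negs /=.
rewrite !(linv_pos, linv_neg).
have nn : neg c != neg b by rewrite xpair_eqE /= andbT.
rewrite (before_neg hu nn) (before_neg hu' nn) lt lt'.
by do 2 case: before.
Qed.

(** The mirror image of [before_mixed_nonmin]: in Cab the pair Ca is not a turn
    since a .. c. *)
Lemma before_mixed_nonmax u u' a b c : same_cone u u' ->
    before u (pos a) (pos c) ->
  before u (neg a) (pos b) = before u' (neg a) (pos b).
Proof.
move=> cn lt; have lt' := lt; rewrite (before_same_sign cn) // in lt'.
have ne : a != c by apply: contraTneq lt => ->; rewrite before_irr.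
have r : reduced [:: neg c; pos a; pos b].
  by rewrite /= !xpair_eqE /= (negbTE ne) !andbF.
have [hu hu' _] := cn.
have := same_cone_turns cn r; rewrite /turns /negs /=.
rewrite !(linv_pos, linv_neg).
have nn : pos a != pos c by rewrite xpair_eqE /= andbT.
rewrite (before_neg hu nn) (before_neg hu' nn) lt lt'.
by do 2 case: before.
Qed.

(** If A .. b in u but b .. A in u', then by the two previous lemmas a is the
    last lowercase letter and B the first uppercase letter, and A, b is the
    only pair on which u and u' disagree.  The distinguishing word is then built
    from turns that the two orders share. *)
Lemma before_mixed_sub u u' a b : 1 < k -> same_cone u u' ->
  before u (neg a) (pos b) -> before u' (neg a) (pos b).
Proof.
move=> k_gt1 cn ltab; apply: contraT => nltab'.
have [hu hu' _] := cn.
have max_a c : c != a -> before u (pos c) (pos a).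
  move=> ca; rewrite (before_neg hu) ?xpair_eqE /= ?andbT 1?eq_sym //.
  by apply: contraNN nltab' => lt; rewrite -(before_mixed_nonmax _ cn lt).
have min_b c : c != b -> before u (neg b) (neg c).
  move=> cb; rewrite (before_neg hu) ?xpair_eqE /= ?andbT //.
  by apply: contraNN nltab' => lt; rewrite -(before_mixed_nonmin _ cn lt).
have same_mixed c d : (c != a) || (d != b) ->
    before u (neg c) (pos d) = before u' (neg c) (pos d).
  case/orP=> [/max_a|/min_b] lt; first exact: before_mixed_nonmax lt.
  exact: before_mixed_nonmin lt.
have ltba' : before u' (pos b) (neg a).
  by rewrite (before_neg hu') // xpair_eqE andbF.
have [eab|ne] := eqVneq a b.
  (* Sorting a and A among the other letters, u' has c .. a .. A .. C for every
     other c, hence so has u except that a and A are exchanged.  In aacA the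
     pairs ac and cA are therefore not turns, and the one negative letter is
     compensated only if aa is a turn. *)
  subst b.
  have [c ca] : exists c : 'I_k, c != a.
    apply/existsP; apply: contraLR k_gt1; rewrite negb_exists => /forallP all_a.
    rewrite -leqNgt -[k]card_ord -(card1 a); apply/subset_leq_card/subsetP => c _.
    by have := all_a c; rewrite negbK inE.
  have ltca' : before u' (pos c) (pos a) by rewrite -(before_same_sign cn) // max_a.
  have ltac' : before u' (neg a) (neg c) by rewrite -(before_same_sign cn) // min_b.
  have nac : before u (neg a) (pos c) = false.
    rewrite same_mixed ?ca ?orbT //; apply/negbTE.
    rewrite -(before_neg hu') ?xpair_eqE ?andbF //.
    exact: before_trans ltca' ltba'.
  have nca : before u (neg c) (neg a) = false.
    by apply/negbTE; rewrite -(before_neg hu) ?min_b // xpair_eqE /= andbT.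
  have r : reduced [:: pos a; pos a; pos c; neg a].
    by rewrite /= !xpair_eqE /= [a == c]eq_sym (negbTE ca) !andbF.
  have := same_cone_turns cn r; rewrite /turns /negs /=.
  rewrite !(linv_pos, linv_neg).
  rewrite -(same_mixed a c) ?ca ?orbT // -(before_same_sign cn (x := neg c) (y := neg a)) //.
  by rewrite nac nca ltab (negbTE nltab').
(* In u the order is B .. A .. b .. a.  In abAB the pair bA is a turn and AB is
   not, for both words, so that the two negative letters are compensated only if
   ab is a turn. *)
have ltBa : before u (neg b) (pos a).
  apply: before_trans (min_b _ ne) _; apply: before_trans ltab _.
  by apply: max_a; rewrite eq_sym.
have r : reduced [:: pos a; pos b; neg a; neg b].
  by rewrite /= !xpair_eqE /= (negbTE ne) !andbF.
have := same_cone_turns cn r; rewrite /turns /negs /=.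
rewrite !(linv_pos, linv_neg).
rewrite !(before_neg _ (x := neg b) (y := pos a)) // ?xpair_eqE ?andbF //.
rewrite -(same_mixed b a) ?ne ?orbT // -(before_same_sign cn (x := neg b) (y := neg a)) //.
by rewrite ltBa min_b // ltab (negbTE nltab').
Qed.

Lemma before_same_cone u u' : 1 < k -> same_cone u u' -> before u =2 before u'.
Proof.
move=> k_gt1 cn; have [hu hu' _] := cn.
have mixed a b : before u (neg a) (pos b) = before u' (neg a) (pos b).
  by apply/idP/idP; apply: before_mixed_sub => //; apply: same_cone_sym.
move=> [a s] [b t]; case: s t => -[]; try exact: before_same_sign.
- have ne : neg b != pos a by rewrite xpair_eqE andbF.
  by rewrite (before_neg hu ne) (before_neg hu' ne) mixed.
- exact: mixed.
Qed.

End Recover.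

Theorem theorem4 (k : nat) (hk : (2 <= k)%N) (u u' : seq (letter k))
    (hu : oriented_word u) (hu' : oriented_word u') (huu' : u <> u') :
  ~ (le_induced u =2 le_induced u').
Proof.
move=> e; apply: huu'; apply: oriented_before_inj => //.
by apply: before_same_cone => //; split=> //; apply: le_induced_poscone.
Qed.
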